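(* On the category $\mathsf C$ of strongly admissible algebraic phases, the completion functor $\mathrm{Cpl}:\mathsf C\to\mathsf C^{\mathrm{cpl}}$ is left adjoint to the inclusion $I:\mathsf C^{\mathrm{cpl}}\hookrightarrow\mathsf C$ of the full subcategory of complete phases.
   Context: Structural signature: the specified class of admissible phase generators, the interaction law governing their composition (a family of finitary basic operations), and the rigidity and defect strata canonically determined by that interaction. An algebraic phase $\mathcal P$ of a given structural signature is a collection of elements carrying the basic operations of the interaction law, with a defect complexity function $\delta:\mathcal P\to\mathbb N\cup\{\infty\}$ determined by the interaction, satisfying $\delta(\circ(x_1,\dots,x_n))\ge\min_j\delta(x_j)$ for every basic operation $\circ$. Its canonical filtration is the finite or bounded descending chain $\mathcal P=\mathcal P^{(0)}\supseteq\mathcal P^{(1)}\supseteq\cdots\supseteq\mathcal P^{(k)}$ with $\mathcal P^{(i)}=\{p:\delta(p)\ge i\}$; the filtration (termination) length $k(\mathcal P)$ is the largest index $k$ with $\mathcal P^{(k)}$ nontrivial. Canonical defect-extension operations: operations extracted functorially from the interaction law, relating $\mathcal P^{(i)}$ and $\mathcal P^{(i-1)}$. The defect control depth $d(\mathcal P)$ is the largest integer $d$ such that defect extension from $\mathcal P^{(i)}$ to $\mathcal P^{(i-1)}$ is functorial and presentation-independent for all $1\le i\le d$ (equivalently, for these $i$, $\mathcal P^{(i-1)}$ is generated canonically from $\mathcal P^{(i)}$ by the canonical defect-extension operations, with no residual choice). $\mathcal P$ is strongly admissible if its filtration has finite length and $k(\mathcal P)=d(\mathcal P)$; then its rigid core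 is $\mathcal P_{\mathrm{rig}}:=\mathcal P^{(k(\mathcal P)-1)}$. Category $\mathsf C$: objects are strongly admissible algebraic phases; morphisms are phase morphisms, i.e. structure-preserving maps $F:\mathcal P\to\mathcal Q$ which preserve the structural signature, interaction law, canonical filtration ($F(\mathcal P^{(i)})\subseteq\mathcal Q^{(i)}$ for all $i$), termination length and defect data; composition and identities are the ordinary ones. Complete phase: $\mathcal P$ is complete if it is terminal among strongly admissible phases equipped with a phase morphism from $\mathcal P$ that does not change the rigid core and does not introduce new defect strata; equivalently, if every phase morphism $\mathcal P\to\mathcal Q$ between strongly admissible phases that is an isomorphism on the rigid core and preserves termination length is an isomorphism of phases. $\mathsf C^{\mathrm{cpl}}\subseteq\mathsf C$ is the full subcategory of complete phases. Completion: for $\mathcal P\in\mathsf C$, $\mathrm{Cpl}(\mathcal P)$ is a chosen object of $\mathsf C^{\mathrm{cpl}}$ with a phase morphism $\eta_{\mathcal P}:\mathcal P\to\mathrm{Cpl}(\mathcal P)$, preserving the rigid core and termination length, which is initial among complete phases under $\mathcal P$: for every complete $\mathcal Q$ and phase morphism $f:\mathcal P\to\mathcal Q$ there is a unique phase morphism $\overline f:\mathrm{Cpl}(\mathcal P)\to\mathcal Q$ with $f=\overline f\circ\eta_{\mathcal P}$. It is assumed that such a completion exists for every $\mathcal P\in\mathsf C$. On a morphism $g:\mathcal P\to\mathcal P'$, $\mathrm{Cpl}(g)$ is the unique morphism with $\eta_{\mathcal P'}\circ g=\mathrm{Cpl}(g)\circ\eta_{\mathcal P}$. *)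

(* Defs.v *)
From mathcomp Require Import all_boot.
From Stdlib Require Import FunctionalExtensionality ProofIrrelevance.
From Stdlib Require Import IndefiniteDescription.

Set Implicit Arguments.
Unset Strict Implicit.
Unset Printing Implicit Defensive.

Record category := Category {
  obj :> Type;
  hom : obj -> obj -> Type;
  idm : forall a, hom a a;
  compm : forall a b c, hom b c -> hom a b -> hom a c;
  comp_idl : forall a b (f : hom a b), compm (idm b) f = f;
  comp_idr : forall a b (f : hom a b), compm f (idm a) = f;
  comp_assoc : forall a b c d (h : hom c d) (g : hom b c) (f : hom a b),
    compm h (compm g f) = compm (compm h g) f
}.
Arguments hom {_} _ _.
Arguments idm {_} _.
Arguments compm {_ _ _ _} _ _.

Record functor (C D : category) := Functor {
  fobj :> C -> D;
  fmap : forall a b : C, hom a b -> hom (fobj a) (fobj b);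
  fmap_id : forall a : C, fmap (idm a) = idm (fobj a);
  fmap_comp : forall (a b c : C) (g : hom b c) (f : hom a b),
    fmap (compm g f) = compm (fmap g) (fmap f)
}.
Arguments fmap {_ _} _ {_ _} _.

Definition is_iso (C : category) (a b : C) (f : hom a b) : Prop :=
  exists g : hom b a, compm g f = idm a /\ compm f g = idm b.

Definition left_adjoint (C D : category)
    (F : functor C D) (G : functor D C) : Prop :=
  exists phi : forall (a : C) (b : D), hom (F a) b -> hom a (G b),
    [/\ forall a b, bijective (@phi a b),
        forall (a a' : C) (b : D) (g : hom a' a) (u : hom (F a) b),
          phi a' b (compm u (fmap F g)) = compm (phi a b u) g
      & forall (a : C) (b b' : D) (h : hom b b') (u : hom (F a) b),
          phi a b' (compm h u) = compm (fmap G h) (phi a b u)].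

Section FullSubcategory.
Variables (C : category) (P : C -> Prop).

Definition full_subcategory : category :=
  @Category {a : C | P a} (fun a b => hom (sval a) (sval b))
    (fun a => idm (sval a)) (fun a b c g f => compm g f)
    (fun a b f => comp_idl f) (fun a b f => comp_idr f)
    (fun a b c d h g f => comp_assoc h g f).

Definition inclusion : functor full_subcategory C :=
  @Functor full_subcategory C (fun a => sval a) (fun a b f => f)
    (fun a => erefl) (fun a b c g f => erefl).

End FullSubcategory.

(* Defect values; [None] is infinity. *)
Definition enat := option nat.

Definition enat_le (a b : enat) : bool :=
  match a, b with
  | _, None => true
  | None, Some _ => false
  | Some m, Some n => m <= n
  end.

Definition enat_min (a b : enat) : enat := if enat_le a b then a else b.

Record interaction_law := InteractionLaw {
  generator : Type;
  op : Type;
  arity : op -> nat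
}.

(* [realizes g x]: the element [x] is an occurrence of the admissible phase
   generator [g]; a generator may have none, one or several occurrences. *)
Record structure (L : interaction_law) := Structure {
  carrier :> Type;
  realizes : generator L -> carrier -> Prop;
  interp : forall o : op L, ('I_(arity o) -> carrier) -> carrier
}.
Arguments realizes {_ _} _ _.
Arguments interp {_ _} _ _.

Record str_hom L (A B : structure L) := StrHom {
  str_fun :> A -> B;
  str_gen : forall g (x : A), realizes g x -> realizes g (str_fun x);
  str_op : forall (o : op L) (x : 'I_(arity o) -> A),
    str_fun (interp o x) = interp o (fun j => str_fun (x j))
}.

Definition str_iso L (A B : structure L) (F : str_hom A B) : Prop :=
  exists G : str_hom B A, cancel F G /\ cancel G F.

Section Substructure.
Variables (L : interaction_law) (A : structure L) (U : A -> Prop).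
Hypothesis U_closed : forall (o : op L) (x : 'I_(arity o) -> A),
  (forall j, U (x j)) -> U (interp o x).

Definition substructure : structure L :=
  @Structure L {x : A | U x} (fun g x => realizes g (sval x))
    (fun o x => exist U (interp o (fun j => sval (x j)))
                  (U_closed (fun j => svalP (x j)))).

End Substructure.

(* That the defect function is determined by the interaction is expressed by
   letting the signature assign one to every structure, invariantly under
   isomorphism.

   [ext i] is the family of canonical defect-extension operations from stratum
   [i] to stratum [i - 1] (only [i >= 1] is ever used).  Whether such an
   operation has exactly one value is the content of defect control, so it is
   given by its graph [ext_rel]; being extracted functorially, this graph is
   preserved by all structure maps that preserve defects. *)
Record signature := Signature {
  law :> interaction_law;
  defect : forall A : structure law, A -> enat;
  defect_iso : forall (A B : structure law) (F : str_hom A B),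
    str_iso F -> forall x : A, defect (F x) = defect x;
  ext : nat -> Type;
  ext_arity : forall i, ext i -> nat;
  ext_rel : forall (A : structure law) i (e : ext i),
    ('I_(ext_arity e) -> A) -> A -> Prop;
  ext_functorial : forall (A B : structure law) (F : str_hom A B),
    (forall x : A, defect (F x) = defect x) ->
    forall i (e : ext i) (x : 'I_(ext_arity e) -> A) (y : A),
      @ext_rel A i e x y -> @ext_rel B i e (fun j => F (x j)) (F y)
}.
Arguments defect {_ _} _.
Arguments ext_arity {_ _} _.
Arguments ext_rel {_ _ _} _ _ _.

(* The minimum over an empty family is infinity, so nullary operations take
   values of infinite defect. *)
Record phase (S : signature) := Phase {
  phase_str :> structure S;
  defect_op : forall (o : op S) (x : 'I_(arity o) -> phase_str),
    enat_le (\big[enat_min/None]_(j < arity o) defect (x j))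
            (defect (interp o x))
}.

Section Phases.
Variable S : signature.
Implicit Types P Q : phase S.

Definition filtration P (i : nat) (x : P) : Prop :=
  enat_le (Some i) (defect x).

(* A subset is trivial when it has at most one element, as for algebras. *)
Definition nontrivial (T : Type) (U : T -> Prop) : Prop :=
  exists x y, [/\ U x, U y & x <> y].

Definition is_termination_length P (k : nat) : Prop :=
  nontrivial (@filtration P k) /\
  forall j, nontrivial (@filtration P j) -> j <= k.

(* Each stratum is closed under the basic operations, so generation is as an
   algebra: by the extension operations together with the basic ones. *)
Inductive generated P (i : nat) : P -> Prop :=
| generated_base x : filtration i x -> generated i x
| generated_op (o : op S) (x : 'I_(arity o) -> P) :
    (forall j, generated i (x j)) -> generated i (interp o x)
| generated_ext (e : ext S i) (x : 'I_(ext_arity e) -> P) y :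
    (forall j, filtration i (x j)) -> filtration i.-1 y -> ext_rel e x y ->
    generated i y.

(* Defect extension from stratum [i] to stratum [i - 1] is canonical: the
   extension operations leave no choice of value, and they generate. *)
Definition controlled P (i : nat) : Prop :=
  (forall (e : ext S i) (x : 'I_(ext_arity e) -> P),
     (forall j, filtration i (x j)) ->
     exists! y : P, filtration i.-1 y /\ ext_rel e x y) /\
  (forall y : P, filtration i.-1 y -> generated i y).

Definition controlled_upto P (d : nat) : Prop :=
  forall i, 1 <= i <= d -> controlled P i.

Definition is_control_depth P (d : nat) : Prop :=
  controlled_upto P d /\ forall d', controlled_upto P d' -> d' <= d.

Record phase_hom P Q := PhaseHom {
  hom_str :> str_hom P Q;
  hom_filtration : forall i (x : P), filtration i x -> filtration i (hom_str x);
  hom_length : forall k, is_termination_length P k <-> is_termination_length Q k;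
  hom_defect : forall x : P, defect (hom_str x) = defect x
}.

Lemma phase_hom_eq P Q (F G : phase_hom P Q) : F =1 G -> F = G.
Proof.
case: F => [[f f1 f2] f3 f4 f5]; case: G => [[g g1 g2] g3 g4 g5] /= fg.
have {}fg : f = g by apply: functional_extensionality.
subst g.
by rewrite (proof_irrelevance _ g1 f1) (proof_irrelevance _ g2 f2) in g3 g5 *;
  congr PhaseHom; apply: proof_irrelevance.
Qed.

Definition str_id (A : structure S) : str_hom A A :=
  @StrHom S A A id (fun g x gx => gx) (fun o x => erefl).

Definition str_comp (A B C : structure S)
    (G : str_hom B C) (F : str_hom A B) : str_hom A C.
Proof.
exists (fun x => G (F x)).
- by move=> g x gx; apply/str_gen/str_gen.
- by move=> o x; rewrite !str_op.
Defined.

Definition phase_id P : phase_hom P P :=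
  @PhaseHom P P (str_id P) (fun i x xi => xi)
    (fun k => iff_refl _) (fun x => erefl).

Definition phase_comp P Q R
    (G : phase_hom Q R) (F : phase_hom P Q) : phase_hom P R.
Proof.
exists (str_comp G F) => /=.
- by move=> i x xi; do 2 apply: hom_filtration.
- by move=> k; rewrite (hom_length F) (hom_length G).
- by move=> x; rewrite !hom_defect.
Defined.

(* [len] is unique when it exists, so bundling it adds no data. *)
Record sa_phase := SaPhase {
  sa_base :> phase S;
  len : nat;
  len_termination : is_termination_length sa_base len;
  len_control : is_control_depth sa_base len
}.

Lemma sa_comp_idl (P Q : sa_phase) (F : phase_hom P Q) :
  phase_comp (phase_id Q) F = F.
Proof. exact: phase_hom_eq. Qed.

Lemma sa_comp_idr (P Q : sa_phase) (F : phase_hom P Q) :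
  phase_comp F (phase_id P) = F.
Proof. exact: phase_hom_eq. Qed.

Lemma sa_comp_assoc (P Q R T : sa_phase) (H : phase_hom R T)
    (G : phase_hom Q R) (F : phase_hom P Q) :
  phase_comp H (phase_comp G F) = phase_comp (phase_comp H G) F.
Proof. exact: phase_hom_eq. Qed.

Definition sa_category : category :=
  @Category sa_phase (fun P Q : sa_phase => phase_hom P Q)
    (fun P : sa_phase => phase_id P)
    (fun (P Q R : sa_phase) G F => phase_comp G F)
    sa_comp_idl sa_comp_idr sa_comp_assoc.

Lemma filtration_closed P i (o : op S) (x : 'I_(arity o) -> P) :
  (forall j, filtration i (x j)) -> filtration i (interp o x).
Proof.
move=> xi; rewrite /filtration; have := defect_op x.
set m := \big[_/_]_(j < _) _; have : enat_le (Some i) m.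
  apply: (big_ind (fun a => enat_le (Some i) a)) => // [a b|j _]; last exact: xi.
  by rewrite /enat_min; case: ifP.
by case: m (defect _) => [m|] [n|] //=; apply: leq_trans.
Qed.

(* With strata indexed by integers, stratum [-1] is the whole phase; this is
   what the truncated predecessor gives when [len P = 0]. *)
Definition rigid_core (P : sa_phase) : structure S :=
  substructure (@filtration_closed P (len P).-1).

Lemma termination_length_uniq P k k' :
  is_termination_length P k -> is_termination_length P k' -> k = k'.
Proof.
by move=> [k1 k2] [k1' k2']; apply/anti_leq; rewrite k2' ?k2.
Qed.

Lemma hom_len (P Q : sa_phase) (F : phase_hom P Q) : len P = len Q.
Proof.
apply: (@termination_length_uniq Q); last exact: len_termination.
by apply/(hom_length F)/len_termination.
Qed.

Lemma hom_core (P Q : sa_phase) (F : phase_hom P Q) (x : P) :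
  filtration (len P).-1 x -> filtration (len Q).-1 (F x).
Proof. by rewrite -(hom_len F); apply: hom_filtration. Qed.

Definition core_map (P Q : sa_phase) (F : phase_hom P Q) :
  str_hom (rigid_core P) (rigid_core Q).
Proof.
exists (fun x => exist _ (F (sval x)) (hom_core F (svalP x))).
- by move=> g [x xi] /= gx; apply: str_gen.
- by move=> o x; apply: eq_sig_hprop => [y|] /=;
    [apply: proof_irrelevance | rewrite str_op].
Defined.

Definition core_preserving (P Q : sa_phase) (F : phase_hom P Q) : Prop :=
  str_iso (core_map F).

(* Not introducing new defect strata is read as keeping the termination
   length. *)
Definition extension (P Q : sa_category) (f : hom P Q) : Prop :=
  core_preserving f /\ len P = len Q.

Lemma extension_id (P : sa_category) : extension (idm P).
Proof.
split=> //; exists (str_id _).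
by split=> -[x xi]; apply: eq_sig_hprop => // y; apply: proof_irrelevance.
Qed.

(* [P], equipped with its identity, is terminal among its extensions. *)
Definition complete (P : sa_category) : Prop :=
  forall (Q : sa_category) (f : hom P Q), extension f ->
    exists! g : hom Q P, compm g f = idm P.

Lemma extension_surjective (P Q : sa_category) (f : hom P Q) :
  extension f -> forall y : Q, exists x : P, (f : phase_hom P Q) x = y.
Proof.
case=> [[h [_ hK]] eqk] y.
suff im n : n <= (len Q).-1 -> forall z : Q, filtration ((len Q).-1 - n) z ->
    exists x : P, (f : phase_hom P Q) x = z.
  apply: (im (len Q).-1) => //; rewrite subnn.
  by rewrite /filtration; case: (defect y).
elim: n => [_ z|n IHn ltn z].
  rewrite subn0 => zi; exists (sval (h (exist _ z zi))).
  by have /(congr1 sval) := hK (exist _ z zi).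
set i := (len Q).-1 - n; have iE : i.-1 = (len Q).-1 - n.+1 by rewrite subnS.
have /andP[i0 ilen] : 1 <= i <= len Q.
  by rewrite subn_gt0 ltn (leq_trans (leq_subr _ _) (leq_pred _)).
rewrite -iE; have [cQ _] := len_control Q; have [cP _] := len_control P.
have [exQ genQ] : controlled Q i by apply: cQ; rewrite i0.
have [exP _] : controlled P i by apply: cP; rewrite i0 eqk.
move=> /genQ; elim=> {z} [z zi|o z _ IHz|e z w zi wi zw].
- exact: IHn (ltnW ltn) _ zi.
- have [x xz] := functional_choice _ IHz; exists (interp o x).
  by rewrite str_op; congr interp; apply: functional_extensionality.
- have zI j := IHn (ltnW ltn) _ (zi j).
  have [x xz] := functional_choice _ zI.
  have xi j : filtration i (x j).
    by rewrite /filtration -(hom_defect (f : phase_hom P Q)) xz; apply: zi.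
  have [y0 [[y0i xy0] _]] := exP e x xi; exists y0.
  have [w' [_ uw]] := exQ e z zi.
  rewrite -(uw w) // -(uw ((f : phase_hom P Q) y0)) //; split.
    exact: hom_filtration.
  have <- : (fun j => (f : phase_hom P Q) (x j)) = z.
    exact: functional_extensionality.
  exact: ext_functorial (hom_defect _) _ _ _ _ xy0.
Qed.

Lemma complete_iso (P : sa_category) :
  complete P <->
  (forall (Q : sa_category) (f : hom P Q), extension f -> is_iso f).
Proof.
split=> cP Q f extf.
  have [g [gf _]] := cP Q f extf; exists g; split=> //.
  apply: phase_hom_eq => y /=.
  have [x <-] := extension_surjective extf y.
  have gfx : (compm g f : phase_hom P P) x = x by rewrite gf.
  by rewrite /= in gfx; rewrite gfx.
have [g [gf fg]] := cP Q f extf; exists g; split=> // g' g'f.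
by rewrite -[g']comp_idr -fg comp_assoc g'f comp_idl.
Qed.

Definition complete_category : category := full_subcategory complete.

Record completion (P : sa_category) := Completion {
  cpl_obj : complete_category;
  unit_map : hom P (inclusion complete cpl_obj);
  unit_core : core_preserving unit_map;
  unit_len : len P = len (inclusion complete cpl_obj);
  cpl_initial : forall (Q : complete_category)
      (f : hom P (inclusion complete Q)),
    exists! fbar : hom cpl_obj Q,
      f = compm (fmap (inclusion complete) fbar) unit_map
}.

Section CompletionFunctor.
Variable cpl : forall P : sa_category, completion P.

Lemma cpl_map_exists (P P' : sa_category) (g : hom P P') :
  exists! h : hom (cpl_obj (cpl P)) (cpl_obj (cpl P')),
    compm (unit_map (cpl P')) g =
    compm (fmap (inclusion complete) h) (unit_map (cpl P)).
Proof. exact: cpl_initial. Qed.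

Definition cpl_map (P P' : sa_category) (g : hom P P') :
    hom (cpl_obj (cpl P)) (cpl_obj (cpl P')) :=
  sval (constructive_indefinite_description _ (cpl_map_exists g)).

Lemma cpl_mapP (P P' : sa_category) (g : hom P P') :
  unique (fun h : hom (cpl_obj (cpl P)) (cpl_obj (cpl P')) =>
    compm (unit_map (cpl P')) g =
    compm (fmap (inclusion complete) h) (unit_map (cpl P))) (cpl_map g).
Proof. exact: svalP. Qed.

Lemma cpl_map_id (P : sa_category) : cpl_map (idm P) = idm (cpl_obj (cpl P)).
Proof.
have [_ u] := cpl_mapP (idm P); apply: u.
by rewrite fmap_id comp_idl comp_idr.
Qed.

Lemma cpl_map_comp (P P' P'' : sa_category) (g : hom P' P'') (f : hom P P') :
  cpl_map (compm g f) = compm (cpl_map g) (cpl_map f).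
Proof.
have [_ u] := cpl_mapP (compm g f); apply: u.
have [gE _] := cpl_mapP g; have [fE _] := cpl_mapP f.
by rewrite fmap_comp -comp_assoc -fE !comp_assoc gE.
Qed.

Definition completion_functor : functor sa_category complete_category :=
  @Functor sa_category complete_category
    (fun P : sa_category => cpl_obj (cpl P))
    cpl_map cpl_map_id cpl_map_comp.

End CompletionFunctor.

End Phases.

Arguments sa_category : clear implicits.
Arguments complete {S} P.
Arguments completion {S} P.

(* Main.v *)
Require Import Defs.
From mathcomp Require Import all_boot.
From Stdlib Require Import IndefiniteDescription.

(** Initiality of the completion says precisely that precomposition with [unit_map] is a bijection
    of hom-sets. It is natural in the complete phase by associativity, and in the other phase
    because the units are natural. *)

Lemma unique_preimage_bijective (A B : Type) (f : A -> B) :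
  (forall y, exists! x, y = f x) -> bijective f.
Proof.
(* Unique existence is a mere proposition; description extracts the inverse function from it. *)
move=> fP; pose g y := constructive_indefinite_description _ (fP y).
exists (fun y => sval (g y)) => [x|y].
  by case: (g (f x)) => x' [_ u] /=; apply: u.
by case: (g y) => x [].
Qed.

Theorem theorem7p6 (S : signature)
    (cpl : forall P : sa_category S, completion P) :
  left_adjoint (completion_functor cpl) (inclusion (@complete S)).
Proof.
exists (fun P Q u =>
  compm (fmap (inclusion (@complete S)) u) (unit_map (cpl P))); split.
- by move=> P Q; apply/unique_preimage_bijective/cpl_initial.
- move=> P P' Q g u; rewrite fmap_comp -!comp_assoc; congr compm.
  (* What remains is the naturality square of the unit at [g], which defines [cpl_map]. *)
  by have [<-] := cpl_mapP cpl g.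
- by move=> P Q Q' h u; rewrite fmap_comp comp_assoc.
Qed.
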